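(* Let $G=(V,E)$ be a connected, locally finite graph, and let $0<p_1<p_2<1$. Let $G_{p_1}$ and $G_{p_2}$ be coupled in the standard monotone way. Then the inequality $$\mathbb{P}\left(|K_{v,p_2}|<\infty\text{ and }\tau\bigl(K_{v,p_2},K_{\infty,p_1}\bigr)\geq n\right)\leq\left(\frac{1-p_2}{1-p_1}\right)^n$$ holds for every $v\in V$ and $n\geq 1$.
   Context: Bernoulli bond percolation: $G_p$ is the random subgraph of $G$ in which each edge is independently open (retained) with probability $p$ and closed (deleted) otherwise; clusters are the connected components of $G_p$. The standard monotone coupling of $G_{p_1}$ and $G_{p_2}$: conditional on $G_{p_1}$, every open edge of $G_{p_1}$ is open in $G_{p_2}$, and the closed edges of $G_{p_1}$ are independently open in $G_{p_2}$ with probability $(p_2-p_1)/(1-p_1)$ (and closed otherwise). $\mathbb{P}$ is the law of the coupled pair. $K_{v,p_2}$ is the cluster of $v$ in $G_{p_2}$, $K_{\infty,p_1}$ is the union of all infinite clusters of $G_{p_1}$, and $\tau(A,B)$ is the number of edges of $G$ with one endpoint in $A$ and the other in $B$. *)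

(* Defs.v *)
From HB Require Import structures.
From Stdlib Require Export Relation_Operators.
From mathcomp Require Export all_boot all_order all_algebra finmap.
From mathcomp Require Export all_classical all_reals all_analysis.

Set Implicit Arguments.
Unset Strict Implicit.
Unset Printing Implicit Defensive.

Import Order.TTheory GRing.Theory Num.Theory.

Local Open Scope classical_set_scope.
Local Open Scope ring_scope.

(* Vertex and edge types may be infinite. Edges are unoriented: [ends e] is the
   unordered set of endpoints. Simplicity is not required: parallel edges and
   loops (where [ends e] is a singleton) are allowed. *)
Record graph := Graph {
  vertex : choiceType;
  edge : choiceType;
  ends : edge -> set vertex;
  endsP : forall e, exists x y, ends e = [set x; y]
}.

Section Graphs.
Variable G : graph.
Implicit Types (H : set (edge G)) (A B : set (vertex G)) (x y v : vertex G).

(* A spanning subgraph of [G] is encoded by its set [H] of retained edges. *)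
Definition adjacent H x y := exists2 e, H e & ends e = [set x; y].

Definition cluster H v : set (vertex G) :=
  [set u | clos_refl_trans (vertex G) (adjacent H) v u].

Definition clusters H : set (set (vertex G)) := range (cluster H).

Definition infinite_clusters_union H : set (vertex G) :=
  \bigcup_(C in [set C | clusters H C /\ infinite_set C]) C.

Definition connected_graph := forall x y, cluster setT x y.

Definition locally_finite := forall x, finite_set [set e : edge G | ends e x].

Definition edges_between A B : set (edge G) :=
  [set e | exists x y, [/\ ends e = [set x; y], A x & B y]].

(* Extended-real valued, as there may be infinitely many such edges. *)
Definition tau (R : realType) A B : \bar R := counting (edges_between A B).

End Graphs.

Arguments tau {G} R A B.

Section Percolation.
Context (d : measure_display) (T : measurableType d) (R : realType).
Variables (P : probability T R) (G : graph).

Definition open_event (omega : T -> set (edge G)) (e : edge G) : set T :=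
  [set t | omega t e].

Definition independent_events (I : choiceType) (A : I -> set T) :=
  forall F : {fset I},
    P (\bigcap_(i in [set` F]) A i) = (\prod_(i <- F) P (A i))%E.

Definition bernoulli_percolation (p : R) (omega : T -> set (edge G)) :=
  [/\ forall e, measurable (open_event omega e),
      forall e, P (open_event omega e) = p%:E
    & independent_events (open_event omega)].

Definition sigma_of (omega : T -> set (edge G)) : set (set T) :=
  <<s range (open_event omega) >>.

(* [f] is a version of the conditional probability P(B | S). *)
Definition is_cond_prob (S : set (set T)) (B : set T) (f : T -> R) :=
  (forall Y : set R, measurable Y -> S (f @^-1` Y)) /\
  (forall A, S A -> P (A `&` B) = \int[P]_(t in A) (f t)%:E)%E.

(* Conditionally on [omega1], the edges are independently open in [omega2],
   with conditional probability 1 for the open edges of [omega1] and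
   (p2 - p1) / (1 - p1) for its closed edges. The joint conditional law of the
   states of finitely many edges is determined by the conditional probabilities
   that all edges of a given finite set are open. *)
Definition monotone_coupling (p1 p2 : R) (omega1 omega2 : T -> set (edge G)) :=
  [/\ bernoulli_percolation p1 omega1,
      forall e, measurable (open_event omega2 e)
    & forall F : {fset edge G},
        is_cond_prob (sigma_of omega1)
          (\bigcap_(e in [set` F]) open_event omega2 e)
          (fun t => \prod_(e <- F)
             if `[< omega1 t e >] then 1 else (p2 - p1) / (1 - p1))].

End Percolation.

(* Main.v *)
From Stdlib Require Import Operators_Properties.
From mathcomp Require Import measurable_realfun.
Require Import Defs.

Set Implicit Arguments.
Unset Strict Implicit.
Unset Printing Implicit Defensive.

Import Order.TTheory GRing.Theory Num.Theory.
Local Open Scope classical_set_scope.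
Local Open Scope ring_scope.

(** Write [B] for the union of the infinite clusters of [Gp1], let
    [q = (p2 - p1) / (1 - p1)], and suppose that the cluster [K] of [v] in
    [Gp2] is finite. Almost surely [Gp1] is contained in [Gp2]
    ([coupling_monotone]); then [K] cannot meet [B], since it would contain an
    infinite cluster, so all the edges of [F = edges_between K B] are closed in
    [Gp2], hence in [Gp1]. Given [Gp1], each of them is closed in [Gp2] with
    probability [1 - q = (1 - p2) / (1 - p1)], and there are at least [n] of
    them; the point is to make this rigorous although [F] depends on [Gp2].

    Instead of exploring [K] edge by edge, the event is decomposed according to
    the values of the pair [(K, F)] of finite sets, with at least [n] edges in
    [F]; there are only countably many of them. For a given pair, consider the events
    - [A], depending on [Gp1] only: [F] is the set of edges between [K] and [B],
      no edge of [F] is open in [Gp1], and [K] does not meet [B];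
    - [C], depending only on the states in [Gp2] of edges outside [F]: the
      cluster of [v] in [Gp2] with [F] removed is [K].
    The pair [(K, F)] is realised only if [A] and [C] hold and all the edges of
    [F] are closed in [Gp2]. By the conditional independence of the edges of
    [Gp2] ([coupling_closed_indep]), this has probability [1 - q] to the power
    [#|F|] times the probability of [A `&` C]. Finally the events [A `&` C] of
    different pairs are disjoint: on [A `&` C], removing from [Gp2] all the
    edges that touch [B] has the same effect on the cluster of [v] as removing
    [F] ([cluster_setD_touching]), so [K], and then [F], can be recovered from
    [Gp1] and [Gp2]. The probabilities of the events [A `&` C] therefore add up
    to at most 1, and the sum over the pairs is at most [(1 - q) ^+ n]
    ([disjoint_cover_bound]).

    The conditional law of [Gp2] is given only through probabilities that
    finitely many edges are open; it extends to the events [C] because those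
    cylinders form a pi-system ([coupling_open_indep]). *)

(** * Sigma-algebras as sets of events *)

(** Three sigma-algebras on one space are in play: the ambient one, the one
    generated by [Gp1], and the one generated by the states in [Gp2] of a set of
    edges. The closure lemmas are therefore about an arbitrary [S]. *)
Lemma sigma_bigcup (T I : Type) (S : set (set T)) (D : set I) (F : I -> set T) :
  sigma_algebra setT S -> countable D -> (forall i, D i -> S (F i)) ->
  S (\bigcup_(i in D) F i).
Proof.
move=> [S0 _ SU] /countable_injP[f f_inj] SF.
have -> : \bigcup_(i in D) F i =
    \bigcup_n \bigcup_(i in [set i | D i /\ f i = n]) F i.
  apply/seteqP; split=> [t [i Di Fit]|t [n _ [i [Di _] Fit]]]; last by exists i.
  by exists (f i) => //; exists i.
apply: SU => n.
have [[i [Di fin]]|noi] := pselect (exists i, D i /\ f i = n).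
  suff -> : [set j | D j /\ f j = n] = [set i] by rewrite bigcup_set1; exact: SF.
  apply/seteqP; split=> [j [Dj fjn]|j ->] //.
  by apply: f_inj; rewrite ?inE// fjn.
suff -> : [set j | D j /\ f j = n] = set0 by rewrite bigcup_set0.
by apply/seteqP; split=> // j [Dj fjn]; case: noi; exists j.
Qed.

Lemma sigma_compl (T : Type) (S : set (set T)) (A : set T) :
  sigma_algebra setT S -> S A -> S (~` A).
Proof. by move=> [_ SC _] SA; rewrite -setTD; exact: SC. Qed.

Lemma sigma_bigcap (T I : Type) (S : set (set T)) (D : set I) (F : I -> set T) :
  sigma_algebra setT S -> countable D -> (forall i, D i -> S (F i)) ->
  S (\bigcap_(i in D) F i).
Proof.
move=> sS cD SF; rewrite -[X in S X]setCK setC_bigcap.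
apply: sigma_compl => //; apply: sigma_bigcup => // i Di.
exact: sigma_compl (SF _ Di).
Qed.

Lemma sigma_setI (T : Type) (S : set (set T)) (A B : set T) :
  sigma_algebra setT S -> S A -> S B -> S (A `&` B).
Proof.
move=> sS SA SB; rewrite -bigcap2E; apply: sigma_bigcap => //.
by move=> [|[|i]] _ //=; rewrite -[setT]setC0; apply: sigma_compl => //; case: sS.
Qed.

Lemma sigma_setU (T : Type) (S : set (set T)) (A B : set T) :
  sigma_algebra setT S -> S A -> S B -> S (A `|` B).
Proof.
move=> sS SA SB; rewrite -[X in S X]setCK setCU.
apply: sigma_compl => //; apply: sigma_setI => //; exact: sigma_compl.
Qed.

Lemma sigma_const (T : Type) (S : set (set T)) (Q : Prop) :
  sigma_algebra setT S -> S [set _ : T | Q].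
Proof.
move=> sS; have S0 : S set0 by case: sS.
have [HQ|nQ] := pselect Q.
  suff -> : [set _ : T | Q] = ~` set0 by exact: sigma_compl.
  by rewrite setC0; apply/seteqP; split.
by suff -> : [set _ : T | Q] = set0 by []; apply/seteqP; split.
Qed.

(** * Measurability of random sets *)

(** Measurability with respect to the sigma-algebra on [set I] generated by the
    coordinates, as for [open_event]. *)
Definition random_set (T I : Type) (S : set (set T)) (X : T -> set I) :=
  forall i, S [set t | X t i].

Lemma random_set_cst (T I : Type) (S : set (set T)) (K : set I) :
  sigma_algebra setT S -> random_set S (fun=> K).
Proof. by move=> sS i; exact: sigma_const. Qed.

Lemma random_setC (T I : Type) (S : set (set T)) (X : T -> set I) :
  sigma_algebra setT S -> random_set S X -> random_set S (fun t => ~` X t).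
Proof. by move=> sS SX i; exact: sigma_compl (SX i). Qed.

Lemma random_setI (T I : Type) (S : set (set T)) (X Y : T -> set I) :
  sigma_algebra setT S -> random_set S X -> random_set S Y ->
  random_set S (fun t => X t `&` Y t).
Proof. by move=> sS SX SY i; exact: sigma_setI (SX i) (SY i). Qed.

Lemma random_set_sub (T I : Type) (S : set (set T)) (X Y : T -> set I) :
  sigma_algebra setT S -> countable [set: I] ->
  random_set S X -> random_set S Y -> S [set t | X t `<=` Y t].
Proof.
move=> sS cI SX SY.
suff -> : [set t | X t `<=` Y t] =
    \bigcap_(i in [set: I]) (~` [set t | X t i] `|` [set t | Y t i]).
  apply: sigma_bigcap => // i _; apply: sigma_setU => //.
  exact: sigma_compl.
apply/seteqP; split=> [t XY i _ /=|t XY i Xi].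
  by have [/XY|] := pselect (X t i); [right|left].
by case: (XY i Logic.I).
Qed.

Lemma random_set_eq (T I : Type) (S : set (set T)) (X Y : T -> set I) :
  sigma_algebra setT S -> countable [set: I] ->
  random_set S X -> random_set S Y -> S [set t | X t = Y t].
Proof.
move=> sS cI SX SY.
suff -> : [set t | X t = Y t] = [set t | X t `<=` Y t] `&` [set t | Y t `<=` X t].
  by apply: sigma_setI => //; exact: random_set_sub.
by apply/seteqP; split=> [t /= ->|t [XY YX]]; [split|exact/seteqP].
Qed.

(** Finite random sets take countably many values, which is what turns the
    events below into countable unions. *)
Lemma countable_finite_sets (I : Type) :
  countable [set: I] -> countable [set K : set I | finite_set K].
Proof.
move=> /countable_finite_subset; apply: sub_countable.
by apply: subset_card_le => K finK; split.
Qed.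

Lemma random_set_finite (T I : Type) (S : set (set T)) (X : T -> set I) :
  sigma_algebra setT S -> countable [set: I] -> random_set S X ->
  S [set t | finite_set (X t)].
Proof.
move=> sS cI SX.
suff -> : [set t | finite_set (X t)] =
    \bigcup_(K in [set K | finite_set K]) [set t | X t = K].
  apply: sigma_bigcup => //; first exact: countable_finite_sets.
  by move=> K _; apply: random_set_eq => //; exact: random_set_cst.
by apply/seteqP; split=> [t Xt|t [K finK /= ->]]; first by exists (X t).
Qed.

(** Having at least [n] elements is witnessed by a finite subset, also when [X]
    is infinite. *)
Lemma le_countingP (I : choiceType) (R : realType) (X : set I) (n : nat) :
  (n%:R%:E <= counting X :> \bar R)%E <->
  exists2 F : set I, finite_set F /\ (n <= #|` fset_set F|)%N & F `<=` X.
Proof.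
rewrite /counting; case: ifPn => [/asboolP|/asboolPn] finX.
  rewrite lee_fin ler_nat; split=> [nX|[F [finF nF] FX]]; first by exists X.
  apply: leq_trans nF _; apply: fsubset_leq_card.
  by apply/fsubsetP => i; rewrite !in_fset_set// !inE; exact: FX.
split=> _; last by rewrite leey.
have [F FX Fn] := infinite_set_fset n finX.
exists [set` F] => //; last by rewrite set_fsetK.
Qed.

Lemma random_set_counting (T : Type) (I : choiceType) (R : realType)
    (S : set (set T)) (X : T -> set I) (n : nat) :
  sigma_algebra setT S -> countable [set: I] -> random_set S X ->
  S [set t | (n%:R%:E <= counting (X t) :> \bar R)%E].
Proof.
move=> sS cI SX.
suff -> : [set t | (n%:R%:E <= counting (X t) :> \bar R)%E] =
    \bigcup_(F in [set F : set I | finite_set F /\ (n <= #|` fset_set F|)%N])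
      [set t | F `<=` X t].
  apply: sigma_bigcup => //.
    apply: sub_countable (countable_finite_sets cI).
    by apply: subset_card_le => K [].
  by move=> F _; apply: random_set_sub => //; exact: random_set_cst.
by apply/seteqP; split=> t; [move/le_countingP|move=> ?; apply/le_countingP].
Qed.

(** * Clusters *)

Lemma cluster_refl (G : graph) (H : set (edge G)) v : cluster H v v.
Proof. exact: rt_refl. Qed.

Lemma cluster_trans (G : graph) (H : set (edge G)) x y z :
  cluster H x y -> cluster H y z -> cluster H x z.
Proof. exact: rt_trans. Qed.

Lemma cluster_sym (G : graph) (H : set (edge G)) x y :
  cluster H x y -> cluster H y x.
Proof.
elim=> {x y} [x y [e He exy]|x|x y z _ yx _ zy]; last exact: rt_trans zy yx.
  by apply: rt_step; exists e; rewrite // exy setUC.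
exact: rt_refl.
Qed.

(** Only the edges at the cluster itself matter: this is both monotonicity and
    the fact that a cluster is unchanged when edges away from it change. *)
Lemma cluster_subset (G : graph) (H H' : set (edge G)) v :
  (forall x y, cluster H v x -> adjacent H x y -> adjacent H' x y) ->
  cluster H v `<=` cluster H' v.
Proof.
move=> HH' u /= /clos_rt_rtn1_iff; elim=> [|x y Hxy vx IH].
  exact: rt_refl.
apply: rt_trans IH _; apply/rt_step/HH' => //.
exact/clos_rt_rtn1_iff.
Qed.

Lemma clusterS (G : graph) (H H' : set (edge G)) v :
  H `<=` H' -> cluster H v `<=` cluster H' v.
Proof.
by move=> HH'; apply: cluster_subset => x y _ [e He exy]; exists e => //; exact: HH'.
Qed.

(** A connection uses a finite path. Since there are countably many finite sets
    of edges, this is what makes clusters measurable. *)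
Lemma cluster_finitary (G : graph) (H : set (edge G)) v u :
  cluster H v u <->
  exists2 X : set (edge G), finite_set X /\ cluster X v u & X `<=` H.
Proof.
split=> [|[X [_ Xvu] XH]]; last exact: clusterS Xvu.
elim=> {v u} [x y [e He exy]|x|x y z _ [X [finX Xxy] XH] _ [Y [finY Yyz] YH]].
- exists [set e]; last by move=> _ ->.
  by split; [exact: finite_set1|apply: rt_step; exists e].
- by exists set0 => //; split; [exact: finite_set0|exact: rt_refl].
exists (X `|` Y); last by move=> e [/XH|/YH].
split; first by rewrite finite_setU.
apply: cluster_trans.
  by apply: clusterS Xxy; exact: subsetUl.
by apply: clusterS Yyz; exact: subsetUr.
Qed.

Lemma infinite_clusters_unionP (G : graph) (H : set (edge G)) u :
  infinite_clusters_union H u <-> infinite_set (cluster H u).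
Proof.
split=> [[_ /= [[w _ <-] infw] Hwu]|infu]; last first.
  by exists (cluster H u); [split=> //; exists u|exact: cluster_refl].
suff -> : cluster H u = cluster H w by [].
apply/seteqP; split=> x; first exact: cluster_trans.
by apply: cluster_trans; exact: cluster_sym.
Qed.

(** * Measurability of clusters *)

Lemma random_cluster (T : Type) (S : set (set T)) (G : graph)
    (omega : T -> set (edge G)) (v : vertex G) :
  sigma_algebra setT S -> countable [set: edge G] -> random_set S omega ->
  random_set S (fun t => cluster (omega t) v).
Proof.
move=> sS cE Som u.
suff -> : [set t | cluster (omega t) v u] =
    \bigcup_(X in [set X : set (edge G) | finite_set X /\ cluster X v u])
      [set t | X `<=` omega t].
  apply: sigma_bigcup => //.
    apply: sub_countable (countable_finite_sets cE).
    by apply: subset_card_le => K [].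
  by move=> X _; apply: random_set_sub => //; exact: random_set_cst.
by apply/seteqP; split=> t /cluster_finitary.
Qed.

Lemma random_infinite_clusters_union (T : Type) (S : set (set T)) (G : graph)
    (omega : T -> set (edge G)) :
  sigma_algebra setT S -> countable [set: vertex G] ->
  countable [set: edge G] -> random_set S omega ->
  random_set S (fun t => infinite_clusters_union (omega t)).
Proof.
move=> sS cV cE Som u.
suff -> : [set t | infinite_clusters_union (omega t) u] =
    ~` [set t | finite_set (cluster (omega t) u)].
  apply: sigma_compl => //; apply: random_set_finite => //; exact: random_cluster.
by apply/seteqP; split=> t /infinite_clusters_unionP.
Qed.

Lemma random_edges_between (T : Type) (S : set (set T)) (G : graph)
    (A B : T -> set (vertex G)) :
  sigma_algebra setT S -> countable [set: vertex G] ->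
  random_set S A -> random_set S B ->
  random_set S (fun t => edges_between (A t) (B t)).
Proof.
move=> sS cV SA SB e.
suff -> : [set t | edges_between (A t) (B t) e] =
    \bigcup_(x in [set: vertex G]) \bigcup_(y in [set y | ends e = [set x; y]])
      ([set t | A t x] `&` [set t | B t y]).
  apply: sigma_bigcup => // x _; apply: sigma_bigcup => //.
    by apply: sub_countable cV; apply: subset_card_le.
  by move=> y _; exact: sigma_setI.
apply/seteqP; split=> [t [x [y [exy Ax By]]]|t [x _ [y exy [Ax By]]]].
  by exists x => //; exists y.
by exists x, y.
Qed.

(** * Local finiteness and countability *)

Definition touching (G : graph) (A : set (vertex G)) : set (edge G) :=
  \bigcup_(x in A) [set e | ends e x].

Lemma finite_touching (G : graph) (A : set (vertex G)) :
  locally_finite G -> finite_set A -> finite_set (touching A).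
Proof. by move=> lfG finA; apply: bigcup_finite. Qed.

Lemma edges_between_touching (G : graph) (A B : set (vertex G)) :
  edges_between A B `<=` touching A `&` touching B.
Proof.
move=> e [x [y [exy Ax By]]]; split; [exists x|exists y] => //=.
- by rewrite exy; left.
- by rewrite exy; right.
Qed.

Lemma finite_ends (G : graph) (e : edge G) : finite_set (ends e).
Proof. by have [x [y ->]] := endsP e; exact: finite_set2. Qed.

(** The balls around a vertex are finite by local finiteness, and they exhaust
    the graph by connectedness. *)
Lemma countable_vertices (G : graph) :
  connected_graph G -> locally_finite G -> countable [set: vertex G].
Proof.
move=> cG lfG.
have [[v _]|noV] := pselect (exists v : vertex G, True); last first.
  suff -> : [set: vertex G] = set0 by exact: countable0.
  by apply/seteqP; split=> // v _; case: noV; exists v.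
pose grow (A : set (vertex G)) := A `|` \bigcup_(e in touching A) ends e.
pose sphere n := iter n grow [set v].
have fin_sphere n : finite_set (sphere n).
  elim: n => [|n IH]; first exact: finite_set1.
  rewrite /sphere iterS finite_setU; split=> //.
  apply: bigcup_finite; first exact: finite_touching.
  by move=> e _; exact: finite_ends.
suff -> : [set: vertex G] = \bigcup_n sphere n.
  by apply: bigcup_countable => // n _; exact: finite_set_countable.
apply/seteqP; split=> // u _.
have /clos_rt_rtn1_iff := cG v u.
elim=> [|x y [e _ exy] _ [n _ sx]]; first by exists 0%N.
exists n.+1 => //; rewrite /sphere iterS; right; exists e.
  by exists x => //=; rewrite exy; left.
by rewrite exy; right.
Qed.

Lemma countable_edges (G : graph) :
  connected_graph G -> locally_finite G -> countable [set: edge G].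
Proof.
move=> cG lfG.
suff -> : [set: edge G] = touching [set: vertex G].
  apply: bigcup_countable; first exact: countable_vertices.
  by move=> x _; exact/finite_set_countable/lfG.
apply/seteqP; split=> // e _; have [x [y exy]] := endsP e.
by exists x => //=; rewrite exy; left.
Qed.

(** * Conditional law of the second configuration *)

Lemma sigma_of_measurable (d : measure_display) (T : measurableType d)
    (G : graph) (omega : T -> set (edge G)) :
  (forall e, measurable (open_event omega e)) -> sigma_of omega `<=` measurable.
Proof.
move=> mom; apply: smallest_sub; first exact: sigma_algebra_measurable.
by move=> _ [e _ <-].
Qed.

Lemma all_open_setU1 (d : measure_display) (T : measurableType d)
    (G : graph) (omega : T -> set (edge G)) e (F : {fset edge G}) :
  \bigcap_(e' in [set` e |` F]%fset) open_event omega e' =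
  open_event omega e `&` \bigcap_(e' in [set` F]) open_event omega e'.
Proof.
apply/seteqP; split=> [t open_eF|t [open_e open_F] e' /=].
  split=> [|e' e'F]; first by apply: open_eF; rewrite /= fset1U1.
  by apply: open_eF; rewrite /= fset1Ur.
by rewrite in_fset1U => /orP[/eqP -> //|]; exact: open_F.
Qed.

(** On [A] the factor of [e] in the conditional probability is the constant
    [(p2 - p1) / (1 - p1)], which comes out of the integral. *)
Lemma coupling_open_step (R : realType) (d : measure_display)
    (T : measurableType d) (P : probability T R) (G : graph) (p1 p2 : R)
    (Gp1 Gp2 : T -> set (edge G)) (A : set T) (e : edge G) (F : {fset edge G}) :
  p1 <= p2 -> p2 < 1 -> monotone_coupling P p1 p2 Gp1 Gp2 ->
  sigma_of Gp1 A -> (forall t, A t -> ~ Gp1 t e) -> e \notin F ->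
  (P (A `&` \bigcap_(e' in [set` e |` F]%fset) open_event Gp2 e') =
   ((p2 - p1) / (1 - p1))%:E * P (A `&` \bigcap_(e' in [set` F]) open_event Gp2 e'))%E.
Proof.
move=> p12 p21 [[mG1 _ _] mG2 cond] SA Ae eF.
have mA : measurable A by exact: sigma_of_measurable SA.
have [mF condF] := cond F.
have q0 : 0 <= (p2 - p1) / (1 - p1).
  by rewrite divr_ge0// subr_ge0// (le_trans p12)// ltW.
rewrite (cond (e |` F)%fset).2// condF// -ge0_integralZl_EFin//; last 2 first.
- by move=> t _; rewrite lee_fin prodr_ge0// => e' _; case: ifP.
- apply/measurable_EFinP => _ Y mY; apply: measurableI => //.
  exact: sigma_of_measurable (mF _ mY).
apply: eq_integral => t; rewrite inE => At.
by rewrite -EFinM big_fsetU1//= asboolF//; exact: Ae.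
Qed.

(** Both sides are finite measures in [C]. They agree on the cylinders, that is
    the events that all edges of a finite set avoiding [e] are open, by
    [coupling_open_step]; these form a pi-system that generates the
    sigma-algebra. *)
Lemma coupling_open_indep (R : realType) (d : measure_display)
    (T : measurableType d) (P : probability T R) (G : graph) (p1 p2 : R)
    (Gp1 Gp2 : T -> set (edge G)) (A C : set T) (e : edge G) :
  p1 <= p2 -> p2 < 1 -> monotone_coupling P p1 p2 Gp1 Gp2 ->
  sigma_of Gp1 A -> (forall t, A t -> ~ Gp1 t e) ->
  <<s [set open_event Gp2 e' | e' in ~` [set e]] >> C ->
  (P (A `&` C `&` open_event Gp2 e) = ((p2 - p1) / (1 - p1))%:E * P (A `&` C))%E.
Proof.
move=> p12 p21 coup SA Ae SC.
have [[mG1 _ _] mG2 _] := coup.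
have mA : measurable A by exact: sigma_of_measurable SA.
have q0 : 0 <= (p2 - p1) / (1 - p1).
  by rewrite divr_ge0// subr_ge0// (le_trans p12)// ltW.
pose cyl : set (set T) :=
  [set \bigcap_(e' in [set` F]) open_event Gp2 e' |
    F in [set F : {fset edge G} | e \notin F]].
have cylT : cyl setT.
  by exists fset0 => //=; apply/seteqP; split=> // t _ e'; rewrite /= in_fset0.
have sub_cyl : [set open_event Gp2 e' | e' in ~` [set e]] `<=` cyl.
  move=> _ [e' /= e'e <-]; exists [fset e']%fset => /=.
    by rewrite in_fset1; apply/eqP => ee'; apply: e'e.
  by rewrite set_fset1 bigcap_set1.
have mcyl : cyl `<=` measurable.
  by move=> _ [F _ <-]; apply: fin_bigcap_measurable.
have cylI : setI_closed cyl.
  move=> _ _ [F /= eF <-] [F' /= eF' <-]; exists (F `|` F')%fset => /=.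
    by rewrite in_fsetU negb_or eF.
  by rewrite set_fsetU bigcap_setU.
have mAe : measurable (A `&` open_event Gp2 e) by exact: measurableI.
pose m1 : {measure set T -> \bar R} := mrestr P mAe.
pose m2 : {measure set T -> \bar R} := mscale (NngNum q0) (mrestr P mA).
have cover : \bigcup_(_ in [set: nat]) [set: T] = setT.
  by apply/seteqP; split=> // t _; exists 0%N.
have m12 B : cyl B -> m1 B = m2 B.
  move=> [F /= eF <-]; rewrite /m1 /m2 /= /mscale /= /mrestr.
  rewrite setIC -setIA -all_open_setU1 [X in (_ * P X)%E]setIC.
  exact: (coupling_open_step _ _ coup).
have m1fin (k : nat) : (m1 setT < +oo)%E.
  by rewrite /m1 /= /mrestr setTI -ge0_fin_numE// fin_num_measure.
have := g_sigma_algebra_measure_unique cyl mcyl (fun=> setT) (fun=> cylT) cover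
  m1 m2 cylI m12 m1fin C (sub_sigma_algebra2 sub_cyl SC).
by rewrite /m1 /m2 /= /mscale /= /mrestr setIC setIAC [C `&` A]setIC.
Qed.

Lemma coupling_closed_indep1 (R : realType) (d : measure_display)
    (T : measurableType d) (P : probability T R) (G : graph) (p1 p2 : R)
    (Gp1 Gp2 : T -> set (edge G)) (A C : set T) (e : edge G) :
  p1 <= p2 -> p2 < 1 -> monotone_coupling P p1 p2 Gp1 Gp2 ->
  sigma_of Gp1 A -> (forall t, A t -> ~ Gp1 t e) ->
  <<s [set open_event Gp2 e' | e' in ~` [set e]] >> C ->
  (P (A `&` C `&` ~` open_event Gp2 e) = ((1 - p2) / (1 - p1))%:E * P (A `&` C))%E.
Proof.
move=> p12 p21 coup SA Ae SC.
have [[mG1 _ _] mG2 _] := coup.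
have mA : measurable A by exact: sigma_of_measurable SA.
have mC : measurable C.
  move: SC; apply: smallest_sub; first exact: sigma_algebra_measurable.
  by move=> _ [e' _ <-].
have mAC : measurable (A `&` C) by exact: measurableI.
have finAC : P (A `&` C) \is a fin_num by exact: fin_num_measure.
rewrite -setDE measureD//; last by rewrite ltey_eq finAC.
have p10 : 1 - p1 != 0 by rewrite gt_eqF// subr_gt0; exact: le_lt_trans p21.
move: (coupling_open_indep p12 p21 coup SA Ae SC) => /= ->.
rewrite -(fineK finAC) -!EFinM -EFinB; congr EFin.
rewrite -[X in X - _]mul1r -mulrBl; congr (_ * _).
by rewrite -[X in X - _](divff p10) -mulrBl opprB addrA subrK.
Qed.

(** The edges are treated one by one: the event that the remaining edges of [s]
    are closed does not depend on the first one, so it can be absorbed into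
    [C]. *)
Lemma coupling_closed_indep (R : realType) (d : measure_display)
    (T : measurableType d) (P : probability T R) (G : graph) (p1 p2 : R)
    (Gp1 Gp2 : T -> set (edge G)) (A C : set T) (s : seq (edge G)) :
  p1 <= p2 -> p2 < 1 -> monotone_coupling P p1 p2 Gp1 Gp2 ->
  uniq s -> sigma_of Gp1 A -> (forall t, A t -> [set` s] `<=` ~` Gp1 t) ->
  <<s [set open_event Gp2 e | e in ~` [set` s]] >> C ->
  (P (A `&` C `&` [set t | [set` s] `<=` ~` Gp2 t]) =
   (((1 - p2) / (1 - p1)) ^+ size s)%:E * P (A `&` C))%E.
Proof.
move=> p12 p21 coup + SA.
elim: s => [|e s IH] /= => [_ _ _|/andP[es us] As SC].
  suff -> : [set t | [set` [::]] `<=` ~` Gp2 t] = setT by rewrite setIT expr0 mul1e.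
  by apply/seteqP; split.
have es_split : [set t | [set` e :: s] `<=` ~` Gp2 t] =
    [set t | [set` s] `<=` ~` Gp2 t] `&` ~` open_event Gp2 e.
  apply/seteqP; split=> t /=.
    move=> open_es; split=> [e' /= e's|]; apply: open_es => /=.
      by rewrite inE e's orbT.
    by rewrite inE eqxx.
  by move=> [open_s open_e] e' /=; rewrite inE => /orP[/eqP ->|]; last exact: open_s.
rewrite es_split setIA -[X in X `&` ~` _]setIA.
rewrite (coupling_closed_indep1 p12 p21 coup SA).
- rewrite setIA IH//.
  + by rewrite muleA -EFinM exprS.
  + by move=> t At e' /= e's; apply: As => //=; rewrite inE e's orbT.
  + move: SC; apply: sub_sigma_algebra2 => _ [e' /= e's <-]; exists e' => //=.
    by apply: contra_not e's => e's; rewrite inE e's orbT.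
- by move=> t At; apply: (As t At) => /=; rewrite inE eqxx.
pose off_e := <<s [set open_event Gp2 e' | e' in ~` [set e]] >>.
have off_eS : sigma_algebra setT off_e by exact: smallest_sigma_algebra.
apply: (@sigma_setI _ off_e) => //.
  move: SC; apply: sub_sigma_algebra2 => _ [e' /= e's <-]; exists e' => //=.
  by apply: contra_not e's => ->; rewrite inE eqxx.
apply: (@sigma_bigcap _ _ off_e [set` s] (fun e' => ~` open_event Gp2 e')) => //.
  exact: finite_set_countable.
move=> e' /= e's; apply: (@sigma_compl _ off_e) => //.
by apply: sub_sigma_algebra; exists e' => //= e'e; move: es; rewrite -e'e e's.
Qed.

(** By countability of the edges it is enough to consider one edge [e]; on the
    event that [e] is open in [Gp1], its conditional probability to be open in
    [Gp2] is 1. *)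
Lemma coupling_monotone (R : realType) (d : measure_display)
    (T : measurableType d) (P : probability T R) (G : graph) (p1 p2 : R)
    (Gp1 Gp2 : T -> set (edge G)) :
  countable [set: edge G] -> monotone_coupling P p1 p2 Gp1 Gp2 ->
  P.-negligible [set t | ~ (Gp1 t `<=` Gp2 t)].
Proof.
move=> /countable_injP[f f_inj] [[mG1 _ _] mG2 cond].
have bad e : P.-negligible (open_event Gp1 e `\` open_event Gp2 e).
  exists (open_event Gp1 e `\` open_event Gp2 e); split=> //.
    exact: measurableD.
  have := (cond [fset e]%fset).2 (open_event Gp1 e).
  rewrite set_fset1 bigcap_set1 => /(_ _) h.
  have {h} : P (open_event Gp1 e `&` open_event Gp2 e) = P (open_event Gp1 e).
    rewrite h; last by apply: sub_sigma_algebra; exists e.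
    rewrite (eq_integral (fun=> 1%E)) ?integral_cst ?mul1e// => t.
    by rewrite inE => Ot; rewrite big_seq_fset1 asboolT.
  have fin1 : P (open_event Gp1 e) \is a fin_num by exact: fin_num_measure.
  move=> Peq; rewrite measureD//; last by rewrite ltey_eq fin1.
  by rewrite [X in (_ - X)%E]Peq subee.
have -> : [set t | ~ (Gp1 t `<=` Gp2 t)] =
    \bigcup_n \bigcup_(e in [set e | f e = n]) (open_event Gp1 e `\` open_event Gp2 e).
  apply/seteqP; split=> [t /existsNP[e /not_implyP[e1 e2]]|t [n _ [e _ [e1 e2]]]].
    by exists (f e) => //; exists e.
  by move/(_ _ e1).
apply: negligible_bigcup => n.
have [[e fe]|noe] := pselect (exists e, f e = n).
  suff -> : [set e | f e = n] = [set e] by rewrite bigcup_set1; exact: bad.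
  apply/seteqP; split=> [e' /= fe'|_ ->//].
  by apply: f_inj; rewrite ?inE// fe fe'.
suff -> : [set e | f e = n] = set0 by rewrite bigcup_set0; exact: negligible_set0.
by apply/seteqP; split=> // e fe; case: noe; exists e.
Qed.

(** * The union bound over a countable index set *)

(** Countable subadditivity for the [U i], followed by countable additivity for
    the disjoint [Q i], whose probabilities add up to at most 1. *)
Lemma disjoint_cover_bound (R : realType) (d : measure_display)
    (T : measurableType d) (P : probability T R) (I : Type) (D : set I)
    (U Q : I -> set T) (A : set T) (c : R) :
  countable D -> 0 <= c -> measurable A ->
  (forall i, D i -> measurable (U i) /\ measurable (Q i)) ->
  (forall i j t, D i -> D j -> Q i t -> Q j t -> i = j) ->
  (forall i, D i -> P (U i) <= c%:E * P (Q i))%E ->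
  P.-negligible (A `\` \bigcup_(i in D) U i) ->
  (P A <= c%:E)%E.
Proof.
move=> /countable_injP[f f_inj] c0 mA mUQ Qdisj UQ [N [mN PN0 AN]].
(* The measure-theoretic lemmas are about sequences: reindex by [f], each
   [fib F n] being either some [F i] or empty. *)
pose fib (F : I -> set T) n := \bigcup_(i in [set i | D i /\ f i = n]) F i.
have fibP n : (exists2 i, D i & forall F, fib F n = F i) \/ (forall F, fib F n = set0).
  have [[i [Di fi]]|noi] := pselect (exists i, D i /\ f i = n); [left|right] => [|F].
    exists i => // F.
    suff -> : fib F n = \bigcup_(j in [set i]) F j by rewrite bigcup_set1.
    congr bigcup; apply/seteqP; split=> [j [Dj fj]|_ -> //].
    by apply: f_inj; rewrite ?inE// fi fj.
  by apply/seteqP; split=> // t [i [Di fi] _]; case: noi; exists i.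
have mfU n : measurable (fib U n).
  by have [[i Di ->]|->] := fibP n; [case: (mUQ _ Di)|].
have mfQ n : measurable (fib Q n).
  by have [[i Di ->]|->] := fibP n; [case: (mUQ _ Di)|].
have fibUQ n : (P (fib U n) <= c%:E * P (fib Q n))%E.
  have [[i Di E]|E] := fibP n; rewrite !E; first exact: UQ.
  by rewrite measure0 mule0.
have tfQ : trivIset setT (fib Q).
  move=> m n _ _ [t [[i [Di fi] Qi] [j [Dj fj] Qj]]].
  by rewrite -fi -fj (Qdisj _ _ _ Di Dj Qi Qj).
have mfUT : measurable (\bigcup_n fib U n) by exact: bigcupT_measurable.
have A_sub : A `<=` N `|` \bigcup_n fib U n.
  move=> t At; have [[i Di Ut]|notU] := pselect ((\bigcup_(i in D) U i) t).
    by right; exists (f i) => //; exists i.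
  by left; apply: AN.
have PU : (P (\bigcup_n fib U n) <= c%:E)%E.
  apply: (@le_trans _ _ (\sum_(0 <= n <oo) P (fib U n))%E).
    exact: measure_sigma_subadditive.
  apply: (@le_trans _ _ (\sum_(0 <= n <oo) (c%:E * P (fib Q n)))%E).
    by apply: lee_nneseries => n _ //.
  rewrite nneseriesZl// -[leRHS]mule1; apply: lee_wpmul2l; first by rewrite lee_fin.
  have := measure_bigcup P setT (fib Q) (fun n _ => mfQ n) tfQ.
  under eq_eseriesl do rewrite in_setT.
  move=> <-; exact/probability_le1/bigcupT_measurable.
apply: le_trans PU.
apply: (@le_trans _ _ (P (N `|` \bigcup_n fib U n))).
  by apply: le_measure; rewrite ?inE//; exact: measurableU.
by rewrite setUC measureU0.
Qed.

(** * Edges between a cluster and a union of infinite clusters *)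

(** The left side of the first hypothesis removes a set of edges that depends on
    [K], whereas the left side of the conclusion mentions [B] only: this is why
    [K] can be recovered from the configurations. It holds because an edge at
    [K] touching [B] is an edge between [K] and [B], as [K] avoids [B]. *)
Lemma cluster_setD_touching (G : graph) (H : set (edge G))
    (K B : set (vertex G)) v :
  cluster (H `\` edges_between K B) v = K -> K `&` B = set0 ->
  cluster (H `\` touching B) v = K.
Proof.
move=> KE KB; rewrite -[RHS]KE; apply/seteqP; split.
  by apply: clusterS => e [He eB]; split=> // /edges_between_touching[_].
apply: cluster_subset => x y; rewrite KE => Kx [e [He eKB] exy].
exists e => //; split=> // -[z Bz /=].
rewrite exy => -[zx|zy].
  by suff : (K `&` B) x; [rewrite KB|split; rewrite // -zx].
by apply: eKB; exists x, y; split=> //; rewrite -zy.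
Qed.

(** A vertex in both sets would have its infinite [H]-cluster inside the finite
    [H']-cluster of [v]. *)
Lemma finite_cluster_disjoint (G : graph) (H H' : set (edge G)) v :
  H `<=` H' -> finite_set (cluster H' v) ->
  cluster H' v `&` infinite_clusters_union H = set0.
Proof.
move=> HH' fin; apply/seteqP; split=> // u [Ku /infinite_clusters_unionP infu].
apply: infu; apply: sub_finite_set fin => w uw.
by apply: cluster_trans Ku _; exact: clusterS uw.
Qed.

Lemma edges_between_closed (G : graph) (H : set (edge G)) (B : set (vertex G)) v :
  cluster H v `&` B = set0 -> edges_between (cluster H v) B `<=` ~` H.
Proof.
move=> KB e [x [y [exy Kx By]]] He.
suff : (cluster H v `&` B) y by rewrite KB.
by split=> //; apply: cluster_trans Kx _; apply: rt_step; exists e.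
Qed.

(** * The inequality *)

Theorem proposition2p1 (R : realType) (d : measure_display)
    (T : measurableType d) (P : probability T R) (G : graph) (p1 p2 : R)
    (Gp1 Gp2 : T -> set (edge G)) :
  connected_graph G -> locally_finite G ->
  0 < p1 -> p1 < p2 -> p2 < 1 ->
  monotone_coupling P p1 p2 Gp1 Gp2 ->
  forall (v : vertex G) (n : nat), (1 <= n)%N ->
  (P [set t | finite_set (cluster (Gp2 t) v) /\
              n%:R%:E <= tau R (cluster (Gp2 t) v)
                               (infinite_clusters_union (Gp1 t))]
   <= (((1 - p2) / (1 - p1)) ^+ n)%:E)%E.
Proof.
move=> cG lfG _ p12 p21 coup v n _.
have cV := countable_vertices cG lfG; have cE := countable_edges cG lfG.
have p12' := ltW p12; have p11 := lt_trans p12 p21.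
have [[mG1 _ _] mG2 _] := coup.
set c := (1 - p2) / (1 - p1).
have c0 : 0 <= c by rewrite divr_ge0// subr_ge0 ltW.
have c1 : c <= 1 by rewrite ler_pdivrMr ?subr_gt0// mul1r lerD2l lerN2.
pose B t := infinite_clusters_union (Gp1 t).
pose D := [set K : set (vertex G) | finite_set K] `*`
  [set F : set (edge G) | finite_set F /\ (n <= #|` fset_set F|)%N].
pose A (i : set (vertex G) * set (edge G)) := [set t |
  [/\ edges_between i.1 (B t) = i.2, i.2 `<=` ~` Gp1 t & i.1 `&` B t = set0]].
pose C (i : set (vertex G) * set (edge G)) := [set t | cluster (Gp2 t `\` i.2) v = i.1].
have s1S : sigma_algebra setT (sigma_of Gp1) by exact: smallest_sigma_algebra.
have rG1 : random_set (sigma_of Gp1) Gp1.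
  by move=> e; apply: sub_sigma_algebra; exists e.
have rB := random_infinite_clusters_union s1S cV cE rG1.
have SA i : sigma_of Gp1 (A i).
  suff -> : A i = [set t | edges_between i.1 (B t) = i.2] `&`
      ([set t | i.2 `<=` ~` Gp1 t] `&` [set t | i.1 `&` B t = set0]).
    apply: (sigma_setI s1S) => //; first apply: (random_set_eq s1S) => //.
    - by apply: (random_edges_between s1S) => //; exact: random_set_cst.
    - exact: random_set_cst.
    apply: (sigma_setI s1S) => //.
      apply: (random_set_sub s1S) => //; first exact: random_set_cst.
      exact: (random_setC s1S).
    apply: (random_set_eq s1S) => //; last exact: random_set_cst.
    by apply: (random_setI s1S) => //; exact: random_set_cst.
  by apply/seteqP; split=> t; [case|case=> ? []].
have SC i : <<s [set open_event Gp2 e | e in ~` i.2] >> (C i).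
  set off := <<s _ >>.
  have offS : sigma_algebra setT off by exact: smallest_sigma_algebra.
  have r2 : random_set off (fun t => Gp2 t `\` i.2).
    move=> e; have [ie|ie] := pselect (i.2 e).
      suff -> : [set t | (Gp2 t `\` i.2) e] = set0 by case: offS.
      by apply/seteqP; split=> // t [].
    suff -> : [set t | (Gp2 t `\` i.2) e] = open_event Gp2 e.
      by apply: sub_sigma_algebra; exists e.
    by apply/seteqP; split=> [t []|t].
  apply: (random_set_eq offS) => //; last exact: random_set_cst.
  exact: (random_cluster v offS cE r2).
have mSA i : measurable (A i) by exact: sigma_of_measurable (SA i).
have mC i : measurable (C i).
  move: (SC i); apply: smallest_sub; first exact: sigma_algebra_measurable.
  by move=> _ [e _ <-].
have mS := @sigma_algebra_measurable _ T.
have rG2 : random_set measurable Gp2 by [].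
have rB' := random_infinite_clusters_union mS cV cE (mG1 : random_set measurable Gp1).
have rK := random_cluster v mS cE rG2.
apply: (@disjoint_cover_bound _ _ _ P _ D
  (fun i => A i `&` C i `&` [set t | i.2 `<=` ~` Gp2 t]) (fun i => A i `&` C i)) => //.
- by apply: countableX; [exact: countable_finite_sets|
    apply: sub_countable (countable_finite_sets cE);
    apply: subset_card_le => F []].
- exact: exprn_ge0.
- apply: (sigma_setI mS) => //; first exact: (random_set_finite mS).
  by apply: (random_set_counting R n mS cE) => //; exact: (random_edges_between mS).
- move=> i _; split; last exact: measurableI.
  apply: measurableI; first exact: measurableI.
  apply: (random_set_sub mS) => //; first exact: random_set_cst.
  exact: (random_setC mS).
(* On [A i `&` C i] the index [i] is a function of the two configurations. *)
- have Qdet i t : (A i `&` C i) t ->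
      i = (cluster (Gp2 t `\` touching (B t)) v,
           edges_between (cluster (Gp2 t `\` touching (B t)) v) (B t)).
    case: i => K F [[/= KF _ KB] /= CK]; move: CK KB.
    by rewrite -KF => CK KB; rewrite (cluster_setD_touching CK KB).
  by move=> i j t _ _ /Qdet Ei /Qdet ->.
- move=> [K F] [/= _ [finF nF]].
  have Fs : F = [set` fset_set F] by rewrite fset_setK.
  have AF t : A (K, F) t -> [set` fset_set F] `<=` ~` Gp1 t by rewrite -Fs => -[].
  move: (SC (K, F)) => /=; rewrite [X in ~` X]Fs => SCF.
  have := coupling_closed_indep p12' p21 coup (fset_uniq (fset_set F)) (SA (K, F)) AF SCF.
  rewrite -Fs -/c => ->; apply: lee_wpmul2r => //.
  by rewrite lee_fin; exact: ler_wiXn2l.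
(* Outside the null set where [Gp1] is not contained in [Gp2], the pair
   formed by the cluster and its edges to [B t] is the required index. *)
apply: negligibleS (coupling_monotone cE coup) => t [[finK ntau] notU] sub12.
apply: notU.
have KB := finite_cluster_disjoint sub12 finK.
set K := cluster (Gp2 t) v in finK ntau KB.
have Fclosed := edges_between_closed KB.
exists (K, edges_between K (B t)).
  split=> //=.
  have finF : finite_set (edges_between K (B t)).
    apply: sub_finite_set (finite_touching lfG finK) => e.
    by case/edges_between_touching.
  split=> //; have /le_countingP[F [finF' nF] FKB] := ntau.
  apply: leq_trans nF _; apply: fsubset_leq_card.
  by apply/fsubsetP => e; rewrite !in_fset_set// !inE; exact: FKB.
split=> //; split.
  by split=> //= e /Fclosed nG2 /sub12.
rewrite /C /=; congr cluster; apply/seteqP; split=> [e []//|e G2e].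
by split=> // /Fclosed.
Qed.
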